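(* Let $R(z)=z^4-2z^2$ on $\mathbb C$, with iterates $R_n$, let $$\Omega=\{w\in\mathbb C:\ (R_n(w))_{n\in\mathbb N_0}\in\ell_2\},$$ and let $K(z,w)=\prod_{n=0}^\infty\big(1+R_n(z)R_n(w)^*\big)$ for $z,w\in\Omega$. Then the pair of operators $$(S_0f)(z)=f(R(z)),\qquad (S_1f)(z)=zf(R(z)),$$ satisfies the Cuntz relations in $\mathcal H(K)$, that is, $$S_i^*S_j=\delta_{ij}I_{\mathcal H(K)}\ \ (i,j\in\{0,1\}),\qquad S_0S_0^*+S_1S_1^*=I_{\mathcal H(K)}.$$
   Context: $c^*$ denotes the complex conjugate of $c\in\mathbb C$; $\mathbb N_0=\{0,1,2,\dots\}$; $R_0(z)=z$ and $R_n=R\circ\cdots\circ R$ ($n$ times). The infinite product defining $K$ converges on $\Omega\times\Omega$ and $K$ is positive definite on $\Omega$; $\mathcal H(K)$ is the reproducing kernel Hilbert space of functions on $\Omega$ with reproducing kernel $K$. $S_0$ and $S_1$ are bounded operators from $\mathcal H(K)$ into itself. *)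

(* Defs.v *)
From Stdlib Require Import Reals Arith.
From Coquelicot Require Import Coquelicot.

Open Scope C_scope.

(** A Hilbert space of functions [X -> C] with reproducing kernel [K].
    The carrier is a Banach space over [C] whose norm comes from the inner
    product [<f, g>], linear in [f] and conjugate-linear in [g].  The map
    [rk_eval] realises its elements as functions on [X]; being linear and
    injective, it identifies the carrier with a vector space of functions.
    By the Moore-Aronszajn theorem such a space exists for every positive
    definite kernel, and it is unique up to an isometry compatible with
    [rk_eval]. *)
Record RKHS (X : Type) (K : X -> X -> C) : Type := {
  rk_space :> CompleteNormedModule C_AbsRing;
  rk_inner : rk_space -> rk_space -> C;
  rk_inner_plus_l : forall f g h : rk_space,
    rk_inner (plus f g) h = rk_inner f h + rk_inner g h;
  rk_inner_scal_l : forall (c : C) (f g : rk_space),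
    rk_inner (scal c f) g = c * rk_inner f g;
  rk_inner_conj : forall f g : rk_space,
    rk_inner g f = Cconj (rk_inner f g);
  rk_inner_norm : forall f : rk_space,
    rk_inner f f = RtoC (norm f ^ 2)%R;
  rk_eval : rk_space -> X -> C;
  rk_eval_plus : forall (f g : rk_space) (x : X),
    rk_eval (plus f g) x = rk_eval f x + rk_eval g x;
  rk_eval_scal : forall (c : C) (f : rk_space) (x : X),
    rk_eval (scal c f) x = c * rk_eval f x;
  rk_eval_inj : forall f g : rk_space,
    (forall x : X, rk_eval f x = rk_eval g x) -> f = g;
  rk_kernel : X -> rk_space;
  rk_kernel_eval : forall w z : X, rk_eval (rk_kernel w) z = K z w;
  rk_reproducing : forall (f : rk_space) (w : X),
    rk_eval f w = rk_inner f (rk_kernel w)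
}.

Arguments rk_space {X K} _.
Arguments rk_inner {X K} _ _ _.
Arguments rk_eval {X K} _ _ _.
Arguments rk_kernel {X K} _ _.

Definition is_adjoint {X : Type} {K : X -> X -> C} (H : RKHS X K)
    (S T : H -> H) : Prop :=
  forall f g : H, rk_inner H (S f) g = rk_inner H f (T g).

(** Adjoints are unique, so the existential only gives names to the adjoints
    of [S0] and [S1]. *)
Definition Cuntz_relations {X : Type} {K : X -> X -> C} (H : RKHS X K)
    (S0 S1 : H -> H) : Prop :=
  exists S0s S1s : H -> H,
    is_adjoint H S0 S0s /\ is_adjoint H S1 S1s /\
    (forall f : H, S0s (S0 f) = f) /\
    (forall f : H, S0s (S1 f) = zero) /\
    (forall f : H, S1s (S0 f) = zero) /\
    (forall f : H, S1s (S1 f) = f) /\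
    (forall f : H, plus (S0 (S0s f)) (S1 (S1s f)) = f).

Fixpoint Cprod (a : nat -> C) (N : nat) : C :=
  match N with
  | O => 1
  | S n => Cprod a n * a n
  end.

(** The limit of the partial products, when it exists. *)
Definition Cinfinite_prod (a : nat -> C) : C :=
  iota
    (fun l : C_CompleteNormedModule =>
       filterlim (fun N : nat => Cprod a N : C_CompleteNormedModule)
         eventually (locally l)).

Definition Rpoly (z : C) : C := z ^ 4 - 2 * z ^ 2.

Definition Riter (n : nat) (z : C) : C := Nat.iter n Rpoly z.

Definition in_Omega (w : C) : Prop :=
  ex_series (fun n : nat => (Cmod (Riter n w) ^ 2)%R).

Definition Omega : Type := {w : C | in_Omega w}.

Definition Omega_val (w : Omega) : C := proj1_sig w.

Lemma Rpoly_in_Omega (w : C) : in_Omega w -> in_Omega (Rpoly w).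
Proof.
intros Hw.
apply ex_series_ext with (fun n : nat => (Cmod (Riter (S n) w) ^ 2)%R).
- intros n. unfold Riter. now rewrite Nat.iter_succ_r.
- now apply (ex_series_incr_1 (fun n : nat => (Cmod (Riter n w) ^ 2)%R)).
Qed.

(** [R] maps [Omega] into itself, so that [f o R] is a function on [Omega]. *)
Definition ROmega (w : Omega) : Omega :=
  exist in_Omega (Rpoly (proj1_sig w))
    (Rpoly_in_Omega (proj1_sig w) (proj2_sig w)).

Definition Kprod (z w : Omega) : C :=
  Cinfinite_prod (fun n : nat =>
    1 + Riter n (Omega_val z) * Cconj (Riter n (Omega_val w))).

(* Main.v *)
Require Import Defs.
From Stdlib Require Import Reals Lra.
From Stdlib Require Import Classical ProofIrrelevance FunctionalExtensionality.
From Stdlib Require Import IndefiniteDescription.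
From Coquelicot Require Import Coquelicot.
Open Scope C_scope.

(** Since [R_0 = id], the first factor of the product splits off:
    [K(z,w) = (1 + z w^* ) K(Rz,Rw)].  Moreover [R] is even and maps [Omega]
    onto itself, every point [u] having a preimage [s <> 0].  Replacing [w] by
    [s] and [-s] in the splitting and adding or subtracting gives

    [S_0 k_u = (k_s + k_{-s}) / 2],   [S_1 k_u = (k_s - k_{-s}) / (2 s^* )],

    where [k_w] is the kernel function at [w]: the candidates for [S_i k_u] are
    explicit elements of the space.  The inner product of any element of the
    form [S_0 a] or [S_1 a] with the corresponding candidate is [a(u)], by
    the reproducing property and the evenness of [R].

    Passing from kernel functions to the whole space is a density argument.
    Kernel functions span a dense subspace (orthogonal projection onto a closed
    subspace), hence a norm-decreasing closed linear relation whose domain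
    contains every kernel function is everywhere defined
    ([bounded_closed_relation_total]).  Applied to the graph of a weighted
    composition operator it gives the isometries [S_0] and [S_1]
    ([weighted_comp_isometry]); applied to the graph of the adjoint of a
    contraction it gives [S_0^*] and [S_1^*] ([adjoint_exists]).

    Then [S_i^* S_i = I] says that [S_i] is isometric.  The range of
    [S_0] consists of even functions, which are orthogonal to the odd functions
    [S_1 k_u], so [S_1^* S_0 = 0] and, taking adjoints, [S_0^* S_1 = 0].
    Finally the splitting of the kernel reads
    [k_z = S_0 k_{Rz} + z^* S_1 k_{Rz}], and pairing [f] with both sides yields
    [f = S_0 S_0^* f + S_1 S_1^* f]. *)

(** * Inner product geometry of a reproducing kernel Hilbert space *)

Section Hilbert.
Context {X : Type} {K : X -> X -> C} (H : RKHS X K).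

Lemma opp_scal (f : H) : opp f = scal (- (1)) f.
Proof. symmetry. apply (scal_opp_one (K := C_AbsRing) f). Qed.

Lemma rk_eval_minus (f g : H) (x : X) :
  rk_eval H (minus f g) x = rk_eval H f x - rk_eval H g x.
Proof.
unfold minus. rewrite opp_scal, rk_eval_plus, rk_eval_scal. ring.
Qed.

Lemma inner_zero_l (g : H) : rk_inner H zero g = 0.
Proof.
transitivity (rk_inner H (scal (RtoC 0) zero) g).
- apply (f_equal (fun f => rk_inner H f g)).
  symmetry. exact (scal_zero_l (K := C_AbsRing) (zero : H)).
- rewrite rk_inner_scal_l. ring.
Qed.

Lemma inner_zero_r (f : H) : rk_inner H f zero = 0.
Proof. rewrite rk_inner_conj, inner_zero_l. unfold Cconj; simpl. now rewrite Ropp_0. Qed.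

Lemma inner_plus_r (f g h : H) :
  rk_inner H f (plus g h) = rk_inner H f g + rk_inner H f h.
Proof.
now rewrite rk_inner_conj, rk_inner_plus_l, Cplus_conj, <- !rk_inner_conj.
Qed.

Lemma inner_scal_r (c : C) (f g : H) :
  rk_inner H f (scal c g) = Cconj c * rk_inner H f g.
Proof.
now rewrite rk_inner_conj, rk_inner_scal_l, Cmult_conj, <- rk_inner_conj.
Qed.

Lemma inner_minus_l (f g h : H) :
  rk_inner H (minus f g) h = rk_inner H f h - rk_inner H g h.
Proof.
unfold minus. rewrite opp_scal, rk_inner_plus_l, rk_inner_scal_l. ring.
Qed.

Lemma inner_minus_r (f g h : H) :
  rk_inner H f (minus g h) = rk_inner H f g - rk_inner H f h.
Proof.
now rewrite rk_inner_conj, inner_minus_l, Cminus_conj, <- !rk_inner_conj.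
Qed.

Lemma norm2_inner (f : H) : (norm f ^ 2)%R = Re (rk_inner H f f).
Proof. now rewrite rk_inner_norm. Qed.

(** The quadratic expansion behind both the Cauchy-Schwarz inequality and the
    characterisation of best approximations by orthogonality. *)
Lemma norm2_minus_scal (c : C) (f g : H) :
  (norm (minus f (scal c g)) ^ 2 =
   norm f ^ 2 - 2 * Re (Cconj c * rk_inner H f g) + Cmod c ^ 2 * norm g ^ 2)%R.
Proof.
rewrite norm2_inner, !inner_minus_l, !inner_minus_r, !rk_inner_scal_l, !inner_scal_r,
  !rk_inner_norm, (rk_inner_conj _ _ H f g), Cmod2_alt.
destruct c as [a b], (rk_inner H f g) as [x y]. simpl. ring.
Qed.

Lemma Cauchy_Schwarz (f g : H) :
  (Cmod (rk_inner H f g) <= norm f * norm g)%R.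
Proof.
generalize (norm_ge_0 f) (norm_ge_0 g) (Cmod_ge_0 (rk_inner H f g)); intros Hf Hg Hc.
destruct Hg as [Hg|Hg].
- destruct (rk_inner H f g) as [x y] eqn:E.
  (* [c = <f, g> / |g|^2] minimises [|f - c g|^2], and the minimum is
     [|f|^2 - |<f, g>|^2 / |g|^2] *)
  assert (P := pow2_ge_0 (norm (minus f (scal (((x / norm g ^ 2)%R, (y / norm g ^ 2)%R) : C) g)))).
  rewrite norm2_minus_scal, E, Cmod2_alt in P.
  assert (Q := Cmod2_alt (x, y)). simpl Re in *; simpl Im in *.
  set (r := Cmod (x, y)) in *.
  replace (_ + _)%R with ((norm f ^ 2 * norm g ^ 2 - (x ^ 2 + y ^ 2)) * / norm g ^ 2)%R in P
    by (simpl; field; lra).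
  assert (0 < / norm g ^ 2)%R by (apply Rinv_0_lt_compat; nra).
  assert (r ^ 2 <= (norm f * norm g) ^ 2)%R.
  { rewrite Q. apply Rnot_lt_le. intros L. nra. }
  apply Rnot_lt_le. intros L.
  assert (0 <= norm f * norm g)%R by nra. nra.
- symmetry in Hg. rewrite (norm_eq_zero g Hg), inner_zero_r, norm_zero, Cmod_0. lra.
Qed.

Lemma parallelogram (f g : H) :
  (norm (plus f g) ^ 2 + norm (minus f g) ^ 2 = 2 * norm f ^ 2 + 2 * norm g ^ 2)%R.
Proof.
rewrite !norm2_inner, inner_minus_l, !inner_minus_r, rk_inner_plus_l, !inner_plus_r.
rewrite !re_plus. unfold Cminus. rewrite ?re_plus, ?re_opp, ?re_plus, ?re_opp. ring.
Qed.

(** Completeness is stated in terms of the balls of the uniform structure; these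
    agree with the norm balls up to a constant factor, which does not affect
    limits of filters. *)
Lemma cauchy_filter_norm_limit (F : (H -> Prop) -> Prop) :
  ProperFilter F ->
  (forall eps : posreal, exists P : H -> Prop,
     F P /\ forall u v : H, P u -> P v -> (norm (minus v u) < eps)%R) ->
  exists l : H, forall eps : posreal, F (fun u => (norm (minus u l) < eps)%R).
Proof.
intros FF HF. exists (lim F). intros eps.
assert (Hc : cauchy F).
{ apply cauchy_distance. intros e. destruct (HF e) as [P [HP Huv]].
  exists P; split; [exact HP|]. intros u v Hu Hv.
  exact (norm_compat1 (K := C_AbsRing) (V := H) u v e (Huv u v Hu Hv)). }
assert (He : (0 < eps / @norm_factor C_AbsRing H)%R).
{ apply Rdiv_lt_0_compat; [apply cond_pos|apply norm_factor_gt_0]. }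
generalize (complete_cauchy F FF Hc (mkposreal _ He)).
apply filter_imp. intros u Hu.
apply (norm_compat2 (K := C_AbsRing) (V := H) _ _ (mkposreal _ He)) in Hu. simpl in Hu.
replace (pos eps) with (@norm_factor C_AbsRing H * (eps / @norm_factor C_AbsRing H))%R; [exact Hu|].
field. generalize (@norm_factor_gt_0 C_AbsRing H); lra.
Qed.

Lemma Cmod_le_eps (c : C) : (forall eps : R, 0 < eps -> Cmod c <= eps)%R -> c = 0.
Proof.
intros E. apply Cmod_eq_0, Rle_antisym; [|apply Cmod_ge_0].
apply le_epsilon. intros e He. rewrite Rplus_0_l. now apply E.
Qed.

Lemma norm_minus_sym (f g : H) : norm (minus f g) = norm (minus g f).
Proof.
rewrite <- (norm_opp (K := C_AbsRing) (minus g f)). f_equal.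
symmetry. exact (opp_minus g f).
Qed.

Lemma norm_minus_triangle (f g h : H) :
  (norm (minus f h) <= norm (minus f g) + norm (minus g h))%R.
Proof.
replace (minus f h) with (plus (minus f g) (minus g h))
  by (symmetry; exact (minus_trans g f h)).
exact (norm_triangle (K := C_AbsRing) (minus f g) (minus g h)).
Qed.

(** * Density of the kernel functions *)

Definition subspace (P : H -> Prop) : Prop :=
  P zero /\
  (forall f g : H, P f -> P g -> P (plus f g)) /\
  (forall (c : C) (f : H), P f -> P (scal c f)).

Definition adherent (P : H -> Prop) (f : H) : Prop :=
  forall eps : R, (0 < eps)%R -> exists p : H, P p /\ (norm (minus f p) < eps)%R.

(** The points of [P] that nearly attain the distance from [f] form a filter,
    which is Cauchy by the parallelogram law; its limit attains the distance.
    Working with this filter instead of a minimising sequence avoids choosing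
    points. *)
Lemma best_approximation (P : H -> Prop) (f : H) :
  subspace P -> (forall g, adherent P g -> P g) ->
  exists p : H, P p /\ forall q : H, P q -> (norm (minus f p) <= norm (minus f q))%R.
Proof.
intros [P0 [Pplus Pscal]] Pclosed.
destruct (completeness (fun x => exists p, P p /\ x = - norm (minus f p))%R)
  as [d' [Hub Hlub]].
{ exists 0%R. intros x [p [_ ->]].
  apply Ropp_le_cancel; rewrite Ropp_0, Ropp_involutive; apply norm_ge_0. }
{ exists (- norm (minus f zero))%R, zero. now split. }
set (d := (- d')%R).
assert (Hd : forall p, P p -> (d <= norm (minus f p))%R).
{ intros p Hp. assert (- norm (minus f p) <= d')%R by (apply Hub; now exists p).
  unfold d; lra. }
assert (Hinf : forall e, (0 < e)%R -> exists p, P p /\ (norm (minus f p) < d + e)%R).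
{ intros e He. apply NNPP. intros N.
  assert (d' <= d' - e)%R; [|lra].
  apply Hlub. intros x [p [Hp ->]].
  apply Rnot_lt_le. intros L. apply N. exists p. split; [exact Hp|]. unfold d; lra. }
assert (Hd0 : (0 <= d)%R).
{ apply Rnot_lt_le. intros L. destruct (Hinf (- d)%R) as [p [_ Hp]]; [lra|].
  generalize (norm_ge_0 (minus f p)). lra. }
set (F := fun S : H -> Prop => exists e : R, (0 < e)%R /\
  forall p, P p -> (norm (minus f p) < d + e)%R -> S p).
assert (FF : ProperFilter F).
{ split.
  - intros S [e [He HS]]. destruct (Hinf e He) as [p [Hp Hpe]]. exists p; auto.
  - split.
    + exists 1%R. split; [lra|auto].
    + intros S T [e [He HS]] [e' [He' HT]]. exists (Rmin e e'). split.
      * now apply Rmin_glb_lt.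
      * intros p Hp Hpe. generalize (Rmin_l e e') (Rmin_r e e'); intros.
        split; [apply HS|apply HT]; trivial; lra.
    + intros S T HST [e [He HS]]. exists e; auto. }
destruct (cauchy_filter_norm_limit F FF) as [l Hl].
{ intros e.
  (* As the midpoint of [u] and [v] is at distance at least [d] from [f],
     [|v - u|^2 <= 4 (d + eta)^2 - 4 d^2 <= 4 eta (2 d + 1)], and [eta] is chosen
     so that this is at most [e^2 / 2]. *)
  set (eta := Rmin 1 (e ^ 2 / (8 * (2 * d + 1)))%R).
  assert (Heta : (0 < eta)%R).
  { apply Rmin_glb_lt; [lra|]. apply Rdiv_lt_0_compat; [apply pow_lt, cond_pos|lra]. }
  exists (fun p => P p /\ (norm (minus f p) < d + eta)%R). split.
  { exists eta. auto. }
  intros u v [Hu Hu'] [Hv Hv'].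
  assert (Hmid : P (scal (RtoC (/ 2)) (plus u v))) by auto.
  apply Hd in Hmid.
  assert (E : (norm (plus (minus f u) (minus f v)) ^ 2
     = 4 * norm (minus f (scal (RtoC (/ 2)) (plus u v))) ^ 2)%R).
  { rewrite !norm2_inner.
    rewrite ?rk_inner_plus_l, ?inner_plus_r, ?inner_minus_l, ?inner_minus_r,
      ?rk_inner_scal_l, ?inner_scal_r, ?rk_inner_plus_l, ?inner_plus_r,
      ?inner_minus_l, ?inner_minus_r.
    destruct (rk_inner H f f), (rk_inner H f u), (rk_inner H f v),
      (rk_inner H u f), (rk_inner H u u), (rk_inner H u v),
      (rk_inner H v f), (rk_inner H v u), (rk_inner H v v).
    simpl. field. }
  assert (E' : norm (minus v u) = norm (minus (minus f u) (minus f v))).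
  { f_equal. apply rk_eval_inj; intros x.
    rewrite !rk_eval_minus. ring. }
  assert (Q : (4 * norm (minus f (scal (RtoC (/ 2)) (plus u v))) ^ 2 +
     norm (minus v u) ^ 2 = 2 * norm (minus f u) ^ 2 + 2 * norm (minus f v) ^ 2)%R).
  { rewrite <- E, E'. exact (parallelogram (minus f u) (minus f v)). }
  clear E E'.
  assert (eta <= 1)%R by apply Rmin_l.
  assert (eta * (8 * (2 * d + 1)) <= e ^ 2)%R.
  { apply Rle_trans with (e ^ 2 / (8 * (2 * d + 1)) * (8 * (2 * d + 1)))%R.
    - apply Rmult_le_compat_r; [lra|apply Rmin_r].
    - right; field; lra. }
  generalize (cond_pos e) (norm_ge_0 (minus f u)) (norm_ge_0 (minus f v))
   (norm_ge_0 (minus v u)) ; intros.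
  set (N := norm (minus v u)) in *. set (A := norm (minus f u)) in *.
  set (B := norm (minus f v)) in *. set (M := norm (minus f (scal (RtoC (/ 2)) (plus u v)))) in *.
  assert (d ^ 2 <= M ^ 2)%R by nra.
  assert (A ^ 2 <= (d + eta) ^ 2)%R by nra.
  assert (B ^ 2 <= (d + eta) ^ 2)%R by nra.
  assert (N ^ 2 <= 4 * eta * (2 * d + 1))%R by nra.
  assert (N ^ 2 < e ^ 2)%R by nra.
  nra. }
assert (Hnear : forall e, (0 < e)%R -> exists p, P p /\ (norm (minus f p) < d + e)%R /\
   (norm (minus l p) < e)%R).
{ intros e He. destruct (Hl (mkposreal e He)) as [e' [He' H']].
  destruct (Hinf (Rmin e e')) as [p [Hp Hpe]]; [now apply Rmin_glb_lt|].
  generalize (Rmin_l e e') (Rmin_r e e'); intros.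
  exists p. repeat split; trivial; [lra|].
  rewrite norm_minus_sym. apply H'; [exact Hp|lra]. }
exists l. split.
{ apply Pclosed. intros e He. destruct (Hnear e He) as [p [Hp [_ Hpl]]]. now exists p. }
intros q Hq. apply Rle_trans with d; [|now apply Hd].
apply le_epsilon. intros e He. destruct (Hnear (e / 2)%R) as [p [_ [H1 H2]]]; [lra|].
generalize (norm_minus_triangle f p l). rewrite (norm_minus_sym p l). lra.
Qed.

(** If [<f - p, q> <> 0] then moving [p] slightly in the direction of
    [<f - p, q> q] brings it strictly closer to [f]. *)
Lemma best_approximation_orthogonal (P : H -> Prop) (f p q : H) :
  subspace P -> P p -> P q ->
  (forall q : H, P q -> (norm (minus f p) <= norm (minus f q))%R) ->
  rk_inner H (minus f p) q = 0.
Proof.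
intros [_ [Pplus Pscal]] Hp Hq Hmin.
destruct (rk_inner H (minus f p) q) as [x y] eqn:E.
(* The added 1 covers [q = 0] and keeps [t |q|^2 < 2], which makes the first order
   decrease dominate the second order term. *)
set (t := (/ (norm q ^ 2 + 1))%R).
assert (Ht : (t * (norm q ^ 2 + 1) = 1)%R).
{ unfold t. apply Rinv_l. generalize (pow2_ge_0 (norm q)); lra. }
assert (Hm := Hmin (plus p (scal ((t * x, t * y)%R : C) q)) ltac:(auto)).
assert (E' : minus f (plus p (scal ((t * x, t * y)%R : C) q)) =
   minus (minus f p) (scal ((t * x, t * y)%R : C) q)).
{ apply rk_eval_inj; intros z.
  rewrite ?rk_eval_minus, ?rk_eval_plus, ?rk_eval_minus, !rk_eval_scal. ring. }
rewrite E' in Hm. clear E'.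
assert (N := norm2_minus_scal ((t * x, t * y)%R : C) (minus f p) q).
rewrite E, Cmod2_alt in N. simpl Re in N; simpl Im in N.
generalize (norm_ge_0 (minus f p)) (norm_ge_0 q) (Rle_0_sqr x) (Rle_0_sqr y); unfold Rsqr; intros.
assert (Hm' : (norm (minus f p) ^ 2 <=
  norm (minus (minus f p) (scal ((t * x, t * y)%R : C) q)) ^ 2)%R) by nra.
rewrite N in Hm'. clear N Hm.
assert (0 < t)%R by (apply Rinv_0_lt_compat; nra).
assert (t * (x ^ 2 + y ^ 2) * (2 - t * norm q ^ 2) <= 0)%R by (simpl in *; nra).
assert (t * norm q ^ 2 <= 1)%R by nra.
assert (x ^ 2 + y ^ 2 = 0)%R.
{ assert (0 <= x ^ 2 + y ^ 2)%R by nra.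
  assert (0 <= t * (x ^ 2 + y ^ 2))%R by nra.
  assert (t * (x ^ 2 + y ^ 2) <= 0)%R by nra. nra. }
assert (x = 0)%R by nra. assert (y = 0)%R by nra. now subst.
Qed.

(** What is orthogonal to every kernel function vanishes at every point, so
    the projection of [f] onto [P] is [f] itself. *)
Lemma kernels_total (P : H -> Prop) :
  subspace P -> (forall g, adherent P g -> P g) ->
  (forall x : X, P (rk_kernel H x)) -> forall f : H, P f.
Proof.
intros Psub Pclosed Pker f.
destruct (best_approximation P f Psub Pclosed) as [p [Hp Hmin]].
replace f with p; [exact Hp|]. apply rk_eval_inj; intros x.
assert (E := best_approximation_orthogonal P f p (rk_kernel H x) Psub Hp (Pker x) Hmin).
rewrite <- rk_reproducing, rk_eval_minus in E.
replace (rk_eval H f x) with (rk_eval H f x - rk_eval H p x + rk_eval H p x) by ring.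
rewrite E. ring.
Qed.

(** Extension by continuity, stated for graphs: neither the span of the
    kernels nor an operator on it has to be constructed beforehand.  The domain
    of [L] is closed because the images of points converging to [f] form a Cauchy
    filter, by boundedness, and [L] is closed. *)
Lemma bounded_closed_relation_total (L : H -> H -> Prop) :
  L zero zero ->
  (forall f g f' g' : H, L f g -> L f' g' -> L (plus f f') (plus g g')) ->
  (forall (c : C) (f g : H), L f g -> L (scal c f) (scal c g)) ->
  (forall f g : H, L f g -> (norm g <= norm f)%R) ->
  (forall f g : H,
    (forall eps : R, (0 < eps)%R -> exists f' g' : H, L f' g' /\
       (norm (minus f f') < eps)%R /\ (norm (minus g g') < eps)%R) -> L f g) ->
  (forall x : X, exists g : H, L (rk_kernel H x) g) ->
  forall f : H, exists g : H, L f g.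
Proof.
intros L0 Lplus Lscal Lbounded Lclosed Lker.
apply kernels_total; [|..|exact Lker].
- repeat split.
  + now exists zero.
  + intros f f' [g Hg] [g' Hg']. exists (plus g g'). auto.
  + intros c f [g Hg]. exists (scal c g). auto.
- intros f Hf.
  assert (Lminus : forall f g f' g', L f g -> L f' g' -> L (minus f f') (minus g g')).
  { intros. unfold minus. rewrite !opp_scal. auto. }
  set (F := fun S : H -> Prop => exists e : R, (0 < e)%R /\
    forall f' g', L f' g' -> (norm (minus f f') < e)%R -> S g').
  assert (FF : ProperFilter F).
  { split.
    - intros S [e [He HS]]. destruct (Hf e He) as [f' [[g' Hg'] Hf']].
      exists g'; eauto.
    - split.
      + exists 1%R. split; [lra|auto].
      + intros S T [e [He HS]] [e' [He' HT]]. exists (Rmin e e'). split.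
        * now apply Rmin_glb_lt.
        * intros f' g' Hg' Hf'. generalize (Rmin_l e e') (Rmin_r e e'); intros.
          split; [apply (HS f')|apply (HT f')]; trivial; lra.
      + intros S T HST [e [He HS]]. exists e; eauto. }
  destruct (cauchy_filter_norm_limit F FF) as [g Hg].
  { intros e. exists (fun g' => exists f', L f' g' /\ (norm (minus f f') < e / 2)%R).
    split.
    - exists (e / 2)%R. split; [|eauto]. generalize (cond_pos e); lra.
    - intros u v [f1 [H1 N1]] [f2 [H2 N2]].
      apply Rle_lt_trans with (1 := Lbounded _ _ (Lminus _ _ _ _ H2 H1)).
      generalize (norm_minus_triangle f2 f f1). rewrite (norm_minus_sym f2 f). lra. }
  exists g. apply Lclosed. intros e He.
  destruct (Hg (mkposreal e He)) as [e' [He' H']].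
  destruct (Hf (Rmin e e')) as [f' [[g' Hg'] Hf']]; [now apply Rmin_glb_lt|].
  generalize (Rmin_l e e') (Rmin_r e e'); intros.
  exists f', g'. repeat split; [exact Hg'|lra|].
  rewrite norm_minus_sym. apply (H' f' g' Hg'). lra.
Qed.

(** Every relation to which [bounded_closed_relation_total] is applied below is an
    intersection of relations of this form, up to conjugation; they are closed by
    the Cauchy-Schwarz inequality. *)
Lemma inner_equation_closed (p q f g : H) :
  (forall eps : R, (0 < eps)%R -> exists f' g' : H,
     rk_inner H f' p = rk_inner H g' q /\
     (norm (minus f f') < eps)%R /\ (norm (minus g g') < eps)%R) ->
  rk_inner H f p = rk_inner H g q.
Proof.
intros HL.
replace (rk_inner H f p)
  with ((rk_inner H f p - rk_inner H g q) + rk_inner H g q) by ring.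
rewrite (Cmod_le_eps (rk_inner H f p - rk_inner H g q)); [ring|].
intros e He.
set (M := (norm p + norm q + 1)%R).
assert (HM : (0 < M)%R).
{ generalize (norm_ge_0 p) (norm_ge_0 q); intros A B. unfold M.
  apply Rplus_le_lt_0_compat; [now apply Rplus_le_le_0_compat|lra]. }
destruct (HL (e / M)%R) as [f' [g' [E [Hf Hg]]]]; [now apply Rdiv_lt_0_compat|].
replace (rk_inner H f p - rk_inner H g q)
  with (rk_inner H (minus f f') p + - rk_inner H (minus g g') q)
  by (rewrite !inner_minus_l, E; ring).
eapply Rle_trans; [apply Cmod_triangle|]. rewrite Cmod_opp.
assert (A := Cauchy_Schwarz (minus f f') p).
assert (B := Cauchy_Schwarz (minus g g') q).
replace e with (e / M * M)%R by (field; lra).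
set (d := (e / M)%R) in *.
apply Rle_trans with (d * norm p + d * norm q)%R.
- apply Rplus_le_compat; (eapply Rle_trans; [eassumption|]);
    apply Rmult_le_compat_r; try apply norm_ge_0; now left.
- assert (0 < d)%R by now apply Rdiv_lt_0_compat. unfold M.
  rewrite !Rmult_plus_distr_l. lra.
Qed.

Lemma inner_injective (f g : H) :
  (forall h : H, rk_inner H h f = rk_inner H h g) -> f = g.
Proof.
intros E. apply rk_eval_inj; intros x.
now rewrite !rk_reproducing, (rk_inner_conj _ _ H _ f), (rk_inner_conj _ _ H _ g), E.
Qed.

Lemma norm_le_of_inner (f g : H) :
  rk_inner H g g = rk_inner H f f -> (norm g <= norm f)%R.
Proof.
intros E. assert (E' : (norm g ^ 2 = norm f ^ 2)%R) by now rewrite !norm2_inner, E.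
generalize (norm_ge_0 f) (norm_ge_0 g). simpl in E'. intros. nra.
Qed.

(** * Adjoints and weighted composition operators *)

(** The relation [forall f, <S f, g> = <f, a>] between [g] and [a] is closed,
    linear in the pair and norm-decreasing, so it is enough to know the adjoint
    on kernel functions. *)
Lemma adjoint_exists (S : H -> H) :
  (forall f : H, (norm (S f) <= norm f)%R) ->
  (forall x : X, exists a : H, forall f : H,
     rk_inner H (S f) (rk_kernel H x) = rk_inner H f a) ->
  exists T : H -> H, is_adjoint H S T.
Proof.
intros HS Hker.
destruct (functional_choice (fun g a => forall f, rk_inner H (S f) g = rk_inner H f a))
  as [T HT].
- apply bounded_closed_relation_total; [..|exact Hker].
  + intros f. now rewrite !inner_zero_r.
  + intros f g f' g' E E' h. now rewrite !inner_plus_r, E, E'.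
  + intros c f g E h. now rewrite !inner_scal_r, E.
  + (* [|a|^2 = <a, a> = <S a, g> <= |S a| |g| <= |a| |g|] *)
    intros g a E. assert (A := Cauchy_Schwarz (S a) g). rewrite E, rk_inner_norm in A.
    rewrite Cmod_R, Rabs_pos_eq in A by apply pow2_ge_0.
    generalize (HS a) (norm_ge_0 a) (norm_ge_0 g); intros B C D.
    apply Rnot_lt_le. intros L.
    assert (norm (S a) * norm g <= norm a * norm g)%R
      by now apply Rmult_le_compat_r.
    assert (norm a * norm g < norm a * norm a)%R
      by (apply Rmult_lt_compat_l; lra).
    simpl in A. lra.
  + intros f g Hfg h.
    rewrite (rk_inner_conj _ _ H f), (rk_inner_conj _ _ H g). f_equal.
    apply inner_equation_closed. intros e He.
    destruct (Hfg e He) as [f' [g' [E N]]]. exists f', g'. split; [|exact N].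
    now rewrite rk_inner_conj, E, <- rk_inner_conj.
- exists T. intros f g. apply HT.
Qed.

Section Weighted_composition.
Variables (m : X -> C) (rho : X -> X).

Definition weighted_comp (a f : H) : Prop :=
  forall z : X, rk_eval H f z = m z * rk_eval H a (rho z).

(** In this form the value equation at [z] is an inner product equation, hence
    closed. *)
Lemma weighted_comp_inner (a f : H) (z : X) :
  rk_eval H f z = m z * rk_eval H a (rho z) <->
  rk_inner H f (rk_kernel H z) =
  rk_inner H a (scal (Cconj (m z)) (rk_kernel H (rho z))).
Proof.
now rewrite inner_scal_r, Cconj_conj, <- !rk_reproducing.
Qed.

(** The second condition on [phi] makes [f |-> m (f o rho)] preserve inner products
    with [phi].  It is required against all pairs of the relation, not only
    against images of kernels, so that it survives linear combinations and
    limits: this is the form that the density argument can propagate. *)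
Lemma weighted_comp_isometry :
  (forall u : X, exists phi : H, weighted_comp (rk_kernel H u) phi /\
     forall a f : H, weighted_comp a f -> rk_inner H f phi = rk_eval H a u) ->
  exists S T : H -> H,
    is_linear S /\ (forall f : H, weighted_comp f (S f)) /\
    is_adjoint H S T /\ (forall f : H, T (S f) = f).
Proof.
intros Hphi.
destruct (functional_choice (fun a f => weighted_comp a f /\
   forall a' f', weighted_comp a' f' -> rk_inner H f' f = rk_inner H a' a))
  as [S HS].
- apply bounded_closed_relation_total.
  + split.
    * intros z. rewrite !rk_reproducing, !inner_zero_l. ring.
    * intros. now rewrite !inner_zero_r.
  + intros f g f' g' [E I] [E' I']. split.
    * intros z. rewrite !rk_eval_plus, E, E'. ring.
    * intros a h Hah. now rewrite !inner_plus_r, (I _ _ Hah), (I' _ _ Hah).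
  + intros c f g [E I]. split.
    * intros z. rewrite !rk_eval_scal, E. ring.
    * intros a h Hah. now rewrite !inner_scal_r, (I _ _ Hah).
  + intros f g [E I]. apply norm_le_of_inner, I, E.
  + intros a f Haf. split.
    * intros z. apply weighted_comp_inner, inner_equation_closed. intros e He.
      destruct (Haf e He) as [a' [f' [[E _] [N1 N2]]]].
      exists f', a'. repeat split; trivial. apply weighted_comp_inner, E.
    * intros a0 f0 E0.
      rewrite (rk_inner_conj _ _ H f), (rk_inner_conj _ _ H a). f_equal.
      apply inner_equation_closed. intros e He.
      destruct (Haf e He) as [a' [f' [[_ I] [N1 N2]]]].
      exists f', a'. repeat split; trivial.
      now rewrite rk_inner_conj, (I _ _ E0), <- rk_inner_conj.
  + intros u. destruct (Hphi u) as [phi [E I]]. exists phi. split; [exact E|].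
    intros a' f' E'. now rewrite (I _ _ E'), rk_reproducing.
- assert (Hev : forall f, weighted_comp f (S f)) by (intros f; apply HS).
  assert (Hin : forall f g, rk_inner H (S f) (S g) = rk_inner H f g)
    by (intros f g; apply HS, Hev).
  assert (Hnorm : forall f, (norm (S f) <= norm f)%R)
    by (intros f; apply norm_le_of_inner, Hin).
  destruct (adjoint_exists S Hnorm) as [T HT].
  { intros z. exists (scal (Cconj (m z)) (rk_kernel H (rho z))).
    intros f. apply weighted_comp_inner, Hev. }
  exists S, T. split; [|split; [exact Hev|split; [exact HT|]]].
  + split.
    * intros f g. apply rk_eval_inj; intros z.
      rewrite rk_eval_plus, !Hev, rk_eval_plus. ring.
    * intros c f. apply rk_eval_inj; intros z.
      rewrite rk_eval_scal, !Hev, rk_eval_scal. ring.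
    * exists 1%R. split; [lra|]. intros f. rewrite Rmult_1_l. apply Hnorm.
  + intros f. apply inner_injective. intros g. now rewrite <- HT, Hin.
Qed.

End Weighted_composition.

End Hilbert.

(** * Cuntz relations from a splitting of the kernel *)

Section Cuntz.
Context {X : Type} {K : X -> X -> C} (H : RKHS X K).
Context (m : X -> C) (rho flip : X -> X).
Context (rho_flip : forall x : X, rho (flip x) = rho x).
Context (m_flip : forall x : X, m (flip x) = - m x).
Context (preimage : forall u : X, exists s : X, m s <> 0 /\ rho s = u).
Context (K_split : forall z w : X,
  K z w = (1 + m z * Cconj (m w)) * K (rho z) (rho w)).

(** The values at the kernel function [k_(rho s)] of the two weighted composition
    operators, with weights [1] and [m]. *)
Definition even_lift (s : X) : H :=
  scal (RtoC (/ 2)) (plus (rk_kernel H s) (rk_kernel H (flip s))).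

Definition odd_lift (s : X) : H :=
  scal (Cconj (/ (2 * m s))) (minus (rk_kernel H s) (rk_kernel H (flip s))).

Lemma C2_neq_0 : RtoC 2 <> 0.
Proof. intros E. apply RtoC_inj in E. lra. Qed.

Lemma inner_even_lift (f : H) (s : X) :
  rk_inner H f (even_lift s) = (rk_eval H f s + rk_eval H f (flip s)) / 2.
Proof.
unfold even_lift. rewrite inner_scal_r, inner_plus_r, <- !rk_reproducing.
replace (Cconj (RtoC (/ 2))) with (/ 2); [unfold Cdiv; ring|].
rewrite <- RtoC_inv by lra. unfold Cconj, RtoC; simpl. now rewrite Ropp_0.
Qed.

Lemma inner_odd_lift (f : H) (s : X) :
  rk_inner H f (odd_lift s) = / (2 * m s) * (rk_eval H f s - rk_eval H f (flip s)).
Proof.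
unfold odd_lift.
now rewrite inner_scal_r, inner_minus_r, <- !rk_reproducing, Cconj_conj.
Qed.

(** Flipping [s] changes the sign of the term [m z (m s)^*] of [K_split] and nothing
    else, so the half sum isolates the part with weight [1] and the
    difference the part with weight [m]. *)
Lemma even_lift_eval (s z : X) :
  rk_eval H (even_lift s) z = 1 * rk_eval H (rk_kernel H (rho s)) (rho z).
Proof.
unfold even_lift.
rewrite rk_eval_scal, rk_eval_plus, !rk_kernel_eval, (K_split z s),
  (K_split z (flip s)), rho_flip, m_flip, Copp_conj, RtoC_inv by lra.
field.
Qed.

Lemma odd_lift_eval (s z : X) :
  m s <> 0 ->
  rk_eval H (odd_lift s) z = m z * rk_eval H (rk_kernel H (rho s)) (rho z).
Proof.
intros Hs. unfold odd_lift.
assert (E : Cconj (/ (2 * m s)) * (2 * Cconj (m s)) = 1).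
{ replace (2 * Cconj (m s)) with (Cconj (2 * m s)).
  - rewrite <- Cmult_conj, Cinv_l.
    + unfold Cconj; simpl. now rewrite Ropp_0.
    + apply Cmult_neq_0; [exact C2_neq_0|exact Hs].
  - rewrite Cmult_conj. unfold Cconj at 1; simpl. now rewrite Ropp_0. }
rewrite rk_eval_scal, rk_eval_minus, !rk_kernel_eval, (K_split z s),
  (K_split z (flip s)), rho_flip, m_flip, Copp_conj.
transitivity (Cconj (/ (2 * m s)) * (2 * Cconj (m s)) * (m z * K (rho z) (rho s)));
  [ring|]. rewrite E. ring.
Qed.

(** The two orthogonality relations come from [S_0 f] being invariant under the
    flip, and completeness of the two ranges from the expansion of [k_z] along
    them, which is the kernel splitting itself. *)
Theorem Cuntz_of_even_odd_splitting :
  exists S0 S1 : H -> H,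
    is_linear S0 /\ is_linear S1 /\
    (forall (f : H) (z : X), rk_eval H (S0 f) z = rk_eval H f (rho z)) /\
    (forall (f : H) (z : X), rk_eval H (S1 f) z = m z * rk_eval H f (rho z)) /\
    Cuntz_relations H S0 S1.
Proof.
destruct (weighted_comp_isometry H (fun _ => 1) rho) as [S0 [S0s [L0 [E0 [A0 I0]]]]].
{ intros u. destruct (preimage u) as [s [Hs <-]]. exists (even_lift s). split.
  - intros z. apply even_lift_eval.
  - intros a f E. rewrite inner_even_lift, !E, rho_flip.
    field. }
destruct (weighted_comp_isometry H m rho) as [S1 [S1s [L1 [E1 [A1 I1]]]]].
{ intros u. destruct (preimage u) as [s [Hs <-]]. exists (odd_lift s). split.
  - intros z. now apply odd_lift_eval.
  - intros a f E. rewrite inner_odd_lift, !E, rho_flip, m_flip.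
    field. exact Hs. }
assert (E0' : forall f z, rk_eval H (S0 f) z = rk_eval H f (rho z)).
{ intros f z. rewrite E0. ring. }
assert (O10 : forall f : H, S1s (S0 f) = zero).
{ intros f. apply rk_eval_inj; intros u. destruct (preimage u) as [s [Hs <-]].
  (* [(S1s (S0 f)) (rho s) = <S0 f, S1 k_(rho s)>], a difference of values of [S0 f]
     at [s] and [flip s] *)
  assert (E : S1 (rk_kernel H (rho s)) = odd_lift s).
  { apply rk_eval_inj; intros z. now rewrite E1, odd_lift_eval. }
  rewrite !rk_reproducing, inner_zero_l, rk_inner_conj, <- A1, <- rk_inner_conj, E,
    inner_odd_lift, !E0', rho_flip. ring. }
exists S0, S1. split; [exact L0|]. split; [exact L1|].
split; [exact E0'|]. split; [exact E1|].
exists S0s, S1s.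
split; [exact A0|]. split; [exact A1|]. split; [exact I0|].
split; [|split; [exact O10|split; [exact I1|]]].
- intros f. apply inner_injective. intros g.
  rewrite <- A0, rk_inner_conj, A1, O10, !inner_zero_r.
  unfold Cconj; simpl. now rewrite Ropp_0.
- intros f. apply rk_eval_inj; intros z.
  assert (E : rk_kernel H z = plus (S0 (rk_kernel H (rho z)))
    (scal (Cconj (m z)) (S1 (rk_kernel H (rho z))))).
  { apply rk_eval_inj; intros x.
    rewrite rk_eval_plus, rk_eval_scal, E0', E1, !rk_kernel_eval, (K_split x z). ring. }
  rewrite rk_eval_plus, E0', E1, (rk_reproducing _ _ H f z), E,
    inner_plus_r, inner_scal_r, Cconj_conj.
  rewrite (rk_inner_conj _ _ H _ f), A0, <- rk_inner_conj, <- rk_reproducing.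
  now rewrite (rk_inner_conj _ _ H _ f), A1, <- rk_inner_conj, <- rk_reproducing.
Qed.

End Cuntz.

(** * The polynomial and its nonzero preimages *)

Lemma Csqrt_exists (c : C) : exists r : C, r * r = c.
Proof.
destruct c as [a b].
set (m := Cmod (a, b)).
assert (Hm : (m * m = a * a + b * b)%R).
{ unfold m, Cmod; simpl fst; simpl snd. rewrite sqrt_sqrt; nra. }
assert (Hm0 : (0 <= m)%R) by apply Cmod_ge_0.
assert (Ha : (- m <= a <= m)%R) by nra.
set (x := sqrt ((m + a) / 2)); set (y := sqrt ((m - a) / 2)).
assert (Hx : (x * x = (m + a) / 2)%R) by (apply sqrt_sqrt; lra).
assert (Hy : (y * y = (m - a) / 2)%R) by (apply sqrt_sqrt; lra).
assert (Hx0 : (0 <= x)%R) by apply sqrt_pos.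
assert (Hy0 : (0 <= y)%R) by apply sqrt_pos.
assert (Hxy : ((2 * (x * y)) ^ 2 = b ^ 2)%R).
{ replace ((2 * (x * y)) ^ 2)%R with (4 * (x * x) * (y * y))%R by ring.
  rewrite Hx, Hy. nra. }
assert (Hxy0 : (0 <= x * y)%R) by nra.
destruct (Rle_dec 0 b) as [Hb|Hb].
- exists (x, y). unfold Cmult; simpl. f_equal; nra.
- exists (x, - y)%R. unfold Cmult; simpl. f_equal; nra.
Qed.

Lemma Rpoly_opp (z : C) : Rpoly (- z) = Rpoly z.
Proof. unfold Rpoly; ring. Qed.

(** Since [R(s) = (s^2 - 1)^2 - 1], a preimage of [u] is obtained by two square
    roots, [q^2 = 1 + u] and [s^2 = 1 + q]; taking [-q] instead of [q] if necessary
    ensures [1 + q <> 0], hence [s <> 0]. *)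
Lemma Rpoly_nonzero_preimage (u : C) : exists s : C, s <> 0 /\ Rpoly s = u.
Proof.
destruct (Csqrt_exists (1 + u)) as [q Hq].
assert (Hq' : exists q : C, q * q = 1 + u /\ 1 + q <> 0).
{ destruct (Ceq_dec (1 + q) 0) as [E|E].
  - exists (- q). split.
    + rewrite <- Hq; ring.
    + replace (1 + - q) with (2 - (1 + q)) by ring.
      rewrite E. intros E2. injection E2. lra.
  - now exists q. }
destruct Hq' as [p [Hp Hp1]].
destruct (Csqrt_exists (1 + p)) as [s Hs].
exists s; split.
- intros E. apply Hp1. rewrite <- Hs, E. ring.
- unfold Rpoly.
  replace (s ^ 4 - 2 * s ^ 2) with ((s * s - 1) * (s * s - 1) - 1) by ring.
  rewrite Hs. replace ((1 + p - 1) * (1 + p - 1)) with (p * p) by ring.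
  rewrite Hp. ring.
Qed.

(** * The infinite product *)

(** The partial products are bounded by [exp (sum |b_n|)], since
    [1 + x <= exp x]; their increments [P_n b_n] are therefore summable. *)
Lemma Cprod_cv (b : nat -> C) :
  ex_series (fun n => Cmod (b n)) ->
  exists l : C_CompleteNormedModule,
    filterlim (fun N : nat => Cprod (fun n => 1 + b n) N : C_CompleteNormedModule)
      eventually (locally l).
Proof.
intros Hb.
set (P := Cprod (fun n => 1 + b n)).
assert (Hexp : forall N, (Cmod (P (S N)) <= exp (sum_n (fun n => Cmod (b n)) N))%R).
{ assert (H1 : forall N x, (Cmod (P N) <= x)%R ->
    (Cmod (P (S N)) <= x * exp (Cmod (b N)))%R).
  { intros N x Hx. change (P (S N)) with (P N * (1 + b N)). rewrite Cmod_mult.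
    apply Rmult_le_compat; try apply Cmod_ge_0; trivial.
    eapply Rle_trans; [apply Cmod_triangle|].
    rewrite Cmod_1. apply exp_ineq1_le. }
  induction N as [|N IH].
  - rewrite sum_O. rewrite <- (Rmult_1_l (exp _)). apply H1.
    change (P O) with (RtoC 1). rewrite Cmod_1. lra.
  - rewrite sum_Sn. unfold plus; simpl plus. rewrite exp_plus. apply H1, IH. }
destruct Hb as [s Hs].
assert (Hsum : forall N, (sum_n (fun n => Cmod (b n)) N <= s)%R).
{ intros N. apply (is_lim_seq_incr_compare (sum_n (fun n => Cmod (b n)))).
  - exact Hs.
  - intros n. rewrite sum_Sn. unfold plus; simpl.
    generalize (Cmod_ge_0 (b (S n))); lra. }
assert (Hbnd : forall N, (Cmod (P (S N)) <= exp s)%R).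
{ intros N. eapply Rle_trans; [apply Hexp|].
  destruct (Hsum N) as [H|H].
  - left; now apply exp_increasing.
  - rewrite H; lra. }
assert (Hser : ex_series (fun n => P (S n) * b (S n) : C_CompleteNormedModule)).
{ apply ex_series_le with (b := fun n => (exp s * Cmod (b (S n)))%R).
  - intros n. change (Cmod (P (S n) * b (S n)) <= exp s * Cmod (b (S n)))%R.
    rewrite Cmod_mult. apply Rmult_le_compat_r; [apply Cmod_ge_0|apply Hbnd].
  - apply (ex_series_scal (V := R_NormedModule) (exp s) (fun n => Cmod (b (S n)))).
    apply (ex_series_incr_1 (fun n => Cmod (b n))). now exists s. }
destruct Hser as [l Hl].
(* Sums of series start at index 0, so the increments are summed from [P 1] on,
   and the [N]-th partial sum, which has [N + 1] terms, leads to [P (N + 2)]. *)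
exists (P 1%nat + l).
assert (Hl' : filterlim (fun N => plus (P 1%nat : C_CompleteNormedModule)
   (sum_n (fun n => P (S n) * b (S n) : C_CompleteNormedModule) N))
   eventually (locally (plus (P 1%nat : C_CompleteNormedModule) l))).
{ eapply filterlim_comp_2; [apply filterlim_const|exact Hl|].
  apply (filterlim_plus (P 1%nat : C_CompleteNormedModule) l). }
assert (Heq : forall N, plus (P 1%nat : C_CompleteNormedModule)
   (sum_n (fun n => P (S n) * b (S n) : C_CompleteNormedModule) N) = P (N + 2)%nat).
{ induction N as [|N IH].
  - rewrite sum_O. change (P 1%nat + P 1%nat * b 1%nat = P 1%nat * (1 + b 1%nat)). ring.
  - rewrite sum_Sn, plus_assoc, IH. rewrite (Nat.add_comm N), (Nat.add_comm (S N)).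
    change (P (S (S N)) + P (S (S N)) * b (S (S N)) =
            P (S (S N)) * (1 + b (S (S N)))). ring. }
intros Q HQ. destruct (Hl' Q HQ) as [N0 HN0].
exists (N0 + 2)%nat. intros n Hn.
replace n with (n - 2 + 2)%nat by now rewrite Nat.sub_add
  by (eapply Nat.le_trans; [|exact Hn]; apply Nat.le_add_l).
rewrite <- Heq. apply HN0. apply Nat.le_add_le_sub_r, Hn.
Qed.

Lemma Cprod_shift (a : nat -> C) (N : nat) :
  Cprod a (S N) = a O * Cprod (fun n => a (S n)) N.
Proof.
induction N as [|N IH]; [simpl; ring|].
change (Cprod a (S N) * a (S N) = a O * (Cprod (fun n => a (S n)) N * a (S N))).
rewrite IH; ring.
Qed.

Lemma Cinfinite_prod_unique (a : nat -> C) (l : C_CompleteNormedModule) :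
  filterlim (fun N : nat => Cprod a N : C_CompleteNormedModule)
    eventually (locally l) ->
  Cinfinite_prod a = l.
Proof.
exact (iota_filterlim_locally (V := C_CompleteNormedModule) (F := eventually)
  (fun N => Cprod a N) l).
Qed.

Lemma Cinfinite_prod_shift (b : nat -> C) :
  ex_series (fun n => Cmod (b n)) ->
  Cinfinite_prod (fun n => 1 + b n) =
  (1 + b O) * Cinfinite_prod (fun n => 1 + b (S n)).
Proof.
intros Hb.
destruct (Cprod_cv (fun n => b (S n))) as [l Hl].
{ now apply (ex_series_incr_1 (fun n => Cmod (b n))). }
rewrite (Cinfinite_prod_unique _ l Hl).
apply Cinfinite_prod_unique.
assert (H : filterlim (fun N => scal (1 + b O)
    (Cprod (fun n => 1 + b (S n)) N : C_CompleteNormedModule))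
   eventually (locally (scal (1 + b O) l))).
{ eapply filterlim_comp; [exact Hl|]. apply (filterlim_scal_r (1 + b O) l). }
intros Q HQ. destruct (H Q HQ) as [N0 HN0].
exists (S N0). intros [|n] Hn; [inversion Hn|].
rewrite Cprod_shift. apply HN0. now apply le_S_n.
Qed.

(** This is where membership in [Omega] enters: both orbits are square summable, and
    [|a b| <= |a|^2 + |b|^2]. *)
Lemma Kprod_summable (z w : Omega) :
  ex_series (fun n => Cmod (Riter n (Omega_val z) * Cconj (Riter n (Omega_val w)))).
Proof.
destruct z as [z Hz], w as [w Hw]; unfold Omega_val; simpl.
apply (ex_series_le (V := R_CompleteNormedModule)) with
  (b := fun n => (Cmod (Riter n z) ^ 2 + Cmod (Riter n w) ^ 2)%R).
- intros n. change (Rabs (Cmod (Riter n z * Cconj (Riter n w)))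
    <= Cmod (Riter n z) ^ 2 + Cmod (Riter n w) ^ 2)%R.
  rewrite Rabs_pos_eq by apply Cmod_ge_0.
  rewrite Cmod_mult, Cmod_conj. nra.
- exact (ex_series_plus (V := R_NormedModule) _ _ Hz Hw).
Qed.

Lemma Riter_S (n : nat) (z : C) : Riter (S n) z = Riter n (Rpoly z).
Proof. apply Nat.iter_succ_r. Qed.

Lemma Kprod_functional_equation (z w : Omega) :
  Kprod z w =
  (1 + Omega_val z * Cconj (Omega_val w)) * Kprod (ROmega z) (ROmega w).
Proof.
unfold Kprod at 1.
rewrite (Cinfinite_prod_shift _ (Kprod_summable z w)).
apply (f_equal (Cmult _)). unfold Kprod. f_equal.
apply functional_extensionality; intros n. now rewrite !Riter_S.
Qed.

(** * The domain [Omega] *)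

(** The orbits of [z] and [-z] differ only in their first term. *)
Lemma in_Omega_opp (z : C) (Hz : in_Omega z) : in_Omega (- z).
Proof.
apply ex_series_incr_1 in Hz. apply ex_series_incr_1.
eapply ex_series_ext; [|exact Hz].
intros n. now rewrite !Riter_S, Rpoly_opp.
Qed.

Definition Omega_opp (z : Omega) : Omega :=
  exist in_Omega (- proj1_sig z) (in_Omega_opp _ (proj2_sig z)).

Lemma Omega_ext (z w : Omega) : Omega_val z = Omega_val w -> z = w.
Proof.
destruct z as [z Hz], w as [w Hw]; unfold Omega_val; simpl; intros ->.
f_equal; apply proof_irrelevance.
Qed.

Lemma ROmega_opp (z : Omega) : ROmega (Omega_opp z) = ROmega z.
Proof. apply Omega_ext, Rpoly_opp. Qed.

Lemma ROmega_nonzero_preimage (u : Omega) :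
  exists s : Omega, Omega_val s <> 0 /\ ROmega s = u.
Proof.
destruct u as [u Hu].
destruct (Rpoly_nonzero_preimage u) as [s [Hs0 Hs]].
assert (H : in_Omega s).
{ apply ex_series_incr_1. eapply ex_series_ext; [|exact Hu].
  intros n. now rewrite Riter_S, Hs. }
exists (exist _ s H); split; [exact Hs0|]. apply Omega_ext, Hs.
Qed.

Theorem theorem7p6 (H : RKHS Omega Kprod) :
  exists S0 S1 : H -> H,
    is_linear S0 /\ is_linear S1 /\
    (forall (f : H) (z : Omega),
       rk_eval H (S0 f) z = rk_eval H f (ROmega z)) /\
    (forall (f : H) (z : Omega),
       rk_eval H (S1 f) z = Omega_val z * rk_eval H f (ROmega z)) /\
    Cuntz_relations H S0 S1.
Proof.
apply (Cuntz_of_even_odd_splitting H Omega_val ROmega Omega_opp).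
- exact ROmega_opp.
- reflexivity.
- exact ROmega_nonzero_preimage.
- exact Kprod_functional_equation.
Qed.
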